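(* Let $R$ be a smooth $K$-algebra. The unique $R$-module homomorphism $t:\Omega^\tau_R\to R^{(1)}$ such that $t\circ\tau=\delta^{(1)}$ is injective. Thus there is a canonical embedding of $\Omega^\tau_R$ into $R^{(1)}$.
   Context: $(K,\delta)$ is a differential field (a field with a derivation $\delta:K\to K$) containing an element $e$ with $\delta(e)=1$. All rings are commutative with unit. A $K$-algebra $R$ is smooth if for every $K$-algebra $C$ and ideal $N\subseteq C$ with $N^2=0$, every $K$-algebra homomorphism $R\to C/N$ lifts to a $K$-algebra homomorphism $R\to C$. $\Omega_R$ denotes the module of absolute Kähler differentials of $R$ (over $\mathbb{Z}$). The module of $\tau$-differentials $\Omega^\tau_R$ is the $R$-module generated by symbols $\tau r$, $r\in R$, with relations $\tau(r+s)=\tau r+\tau s$, $\tau(rs)=r\,\tau s+s\,\tau r$ for $r,s\in R$, and $\delta(a)\tau b=\delta(b)\tau a$ for $a,b\in K$; $\tau:R\to\Omega^\tau_R$ is $r\mapsto\tau r$. The prolongation of $R$ is $R^{(1)}=\mathrm{Sym}_R(\Omega_R)/I$, where $I$ is the ideal generated by $\{da-\delta(a)\mid a\in K\}$, and $\delta^{(1)}:R\to R^{(1)}$ is the derivation sending $r$ to the class of $dr$. *)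

(* Defs.v *)
From HB Require Import structures.
From mathcomp Require Import all_boot all_algebra.
From mathcomp Require Import boolp classical_sets.

Set Implicit Arguments.
Unset Strict Implicit.
Unset Printing Implicit Defensive.

Import GRing.Theory.
Local Open Scope ring_scope.
Local Open Scope classical_set_scope.
Local Open Scope quotient_scope.

(** Rings are [comPzRingType]s, so that the zero ring is allowed: a prolongation
    may be zero. As MathComp's [comAlgType] excludes it, a K-algebra [R] is
    given by its structure morphism [iota : {rmorphism K -> R}]. *)

Definition derivation (A : pzRingType) (delta : A -> A) : Prop :=
  {morph delta : x y / x + y} /\
  (forall x y, delta (x * y) = x * delta y + y * delta x).

(** MathComp's [{ideal_quot I}] only deals with proper ideals, hence [quotring]. *)

Record ideal (A : comPzRingType) := Ideal {
  ideal_set :> A -> Prop;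
  ideal0 : ideal_set 0;
  idealD : forall x y, ideal_set x -> ideal_set y -> ideal_set (x + y);
  idealM : forall a x, ideal_set x -> ideal_set (a * x) }.

Section IdealGen.
Variables (A : comPzRingType) (S : set A).

Definition ideal_gen_set : set A :=
  [set x | forall I : ideal A, (forall s, S s -> I s) -> I x].

Fact ideal_gen0 : ideal_gen_set 0.
Proof. by move=> I _; apply: ideal0. Qed.

Fact ideal_genD x y :
  ideal_gen_set x -> ideal_gen_set y -> ideal_gen_set (x + y).
Proof. by move=> Sx Sy I SI; apply: idealD; [apply: Sx | apply: Sy]. Qed.

Fact ideal_genM a x : ideal_gen_set x -> ideal_gen_set (a * x).
Proof. by move=> Sx I SI; apply: idealM; apply: Sx. Qed.

Definition ideal_gen : ideal A := Ideal ideal_gen0 ideal_genD ideal_genM.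

End IdealGen.

Section QuotRing.
Variables (A : comPzRingType) (I : ideal A).

Fact idealN x : I x -> I (- x).
Proof. by move=> Ix; rewrite -mulN1r; apply: idealM. Qed.

Definition ideal_eqv : rel A := fun x y => `[< I (x - y) >].

Fact ideal_eqv_refl : reflexive ideal_eqv.
Proof. by move=> x; apply/asboolP; rewrite subrr; apply: ideal0. Qed.

Fact ideal_eqv_sym : symmetric ideal_eqv.
Proof.
move=> x y; apply/idP/idP => /asboolP/idealN H; apply/asboolP;
  by rewrite opprB in H.
Qed.

Fact ideal_eqv_trans : transitive ideal_eqv.
Proof.
move=> y x z /asboolP Hxy /asboolP Hyz; apply/asboolP.
by rewrite -(subrKA y); apply: idealD.
Qed.

Canonical ideal_equiv :=
  EquivRel ideal_eqv ideal_eqv_refl ideal_eqv_sym ideal_eqv_trans.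

Definition quotring : Type := {eq_quot ideal_equiv}.

HB.instance Definition _ := Choice.on quotring.

Definition quotring_pi (x : A) : quotring := \pi_{eq_quot ideal_equiv} x.

Definition quotring_repr (x : quotring) : A :=
  repr (x : {eq_quot ideal_equiv}).

Lemma quotring_reprK : cancel quotring_repr quotring_pi.
Proof. exact: reprK. Qed.

Lemma quotring_piP x y : quotring_pi x = quotring_pi y <-> I (x - y).
Proof. by split=> [/eqmodP/asboolP//|H]; apply/eqmodP/asboolP. Qed.

Definition quotring_zero : quotring := quotring_pi 0.
Definition quotring_one : quotring := quotring_pi 1.
Definition quotring_opp (x : quotring) := quotring_pi (- quotring_repr x).
Definition quotring_add (x y : quotring) :=
  quotring_pi (quotring_repr x + quotring_repr y).
Definition quotring_mul (x y : quotring) :=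
  quotring_pi (quotring_repr x * quotring_repr y).

Lemma quotring_pi_opp x : quotring_opp (quotring_pi x) = quotring_pi (- x).
Proof.
apply/quotring_piP; rewrite -opprD; apply: idealN.
by apply/quotring_piP; rewrite quotring_reprK.
Qed.

Lemma quotring_pi_add x y :
  quotring_add (quotring_pi x) (quotring_pi y) = quotring_pi (x + y).
Proof.
apply/quotring_piP; rewrite opprD addrACA.
by apply: idealD; apply/quotring_piP; rewrite quotring_reprK.
Qed.

Lemma quotring_pi_mul x y :
  quotring_mul (quotring_pi x) (quotring_pi y) = quotring_pi (x * y).
Proof.
apply/quotring_piP; set x' := quotring_repr _; set y' := quotring_repr _.
have -> : x' * y' - x * y = x' * (y' - y) + y * (x' - x).
  by rewrite !mulrBr addrA [y * x']mulrC [y * x]mulrC subrK.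
by apply: idealD; apply: idealM; apply/quotring_piP; rewrite quotring_reprK.
Qed.

Let quotW (P : quotring -> Prop) : (forall x, P (quotring_pi x)) -> forall u, P u.
Proof. by move=> H u; rewrite -[u]quotring_reprK. Qed.

Fact quotring_addA : associative quotring_add.
Proof.
by do 3!elim/quotW => ?; rewrite !quotring_pi_add addrA.
Qed.
Fact quotring_addC : commutative quotring_add.
Proof. by do 2!elim/quotW => ?; rewrite !quotring_pi_add addrC. Qed.
Fact quotring_add0 : left_id quotring_zero quotring_add.
Proof. by elim/quotW => ?; rewrite quotring_pi_add add0r. Qed.
Fact quotring_addN : left_inverse quotring_zero quotring_opp quotring_add.
Proof. by elim/quotW => ?; rewrite quotring_pi_opp quotring_pi_add addNr. Qed.

HB.instance Definition _ := GRing.isZmodule.Build quotring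
  quotring_addA quotring_addC quotring_add0 quotring_addN.

Fact quotring_mulA : associative quotring_mul.
Proof. by do 3!elim/quotW => ?; rewrite !quotring_pi_mul mulrA. Qed.
Fact quotring_mulC : commutative quotring_mul.
Proof. by do 2!elim/quotW => ?; rewrite !quotring_pi_mul mulrC. Qed.
Fact quotring_mul1 : left_id quotring_one quotring_mul.
Proof. by elim/quotW => ?; rewrite quotring_pi_mul mul1r. Qed.
Fact quotring_mulDl : left_distributive quotring_mul +%R.
Proof.
do 3!elim/quotW => ?.
by rewrite -[_ + _]/(quotring_add _ _) -[RHS]/(quotring_add _ _)
  !(quotring_pi_mul, quotring_pi_add) mulrDl.
Qed.

HB.instance Definition _ := GRing.Zmodule_isComPzRing.Build quotring
  quotring_mulA quotring_mulC quotring_mul1 quotring_mulDl.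

Fact quotring_pi_is_zmod_morphism : zmod_morphism quotring_pi.
Proof. by move=> x y; rewrite -quotring_pi_add -quotring_pi_opp. Qed.
Fact quotring_pi_is_monoid_morphism : monoid_morphism quotring_pi.
Proof. by split=> // x y; rewrite -quotring_pi_mul. Qed.

HB.instance Definition _ := GRing.isZmodMorphism.Build A quotring quotring_pi
  quotring_pi_is_zmod_morphism.
HB.instance Definition _ := GRing.isMonoidMorphism.Build A quotring quotring_pi
  quotring_pi_is_monoid_morphism.

End QuotRing.

Definition square_zero (C : comPzRingType) (N : ideal C) : Prop :=
  forall x y, N x -> N y -> x * y = 0.

Definition smooth (K R : comPzRingType) (iota : {rmorphism K -> R}) : Prop :=
  forall (C : comPzRingType) (kappa : {rmorphism K -> C}) (N : ideal C),
    square_zero N ->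
  forall f : {rmorphism R -> quotring N},
    (forall a, f (iota a) = quotring_pi N (kappa a)) ->
  exists g : {rmorphism R -> C},
    (forall a, g (iota a) = kappa a) /\
    (forall r, quotring_pi N (g r) = f r).

(** [presmod rel] is the R-module generated by symbols indexed by [X] with a
    relation [u = v] whenever [rel u v]: formal R-linear expressions modulo the
    smallest congruence containing the module axioms and [rel]. *)

Inductive modterm (R X : Type) : Type :=
| MGen of X
| MZero
| MOpp of modterm R X
| MAdd of modterm R X & modterm R X
| MScale of R & modterm R X.
Arguments MGen {R X}.
Arguments MZero {R X}.

HB.instance Definition _ R X := gen_eqMixin (modterm R X).
HB.instance Definition _ R X := gen_choiceMixin (modterm R X).

Inductive modcong (R : pzRingType) (X : Type)
    (rel : modterm R X -> modterm R X -> Prop) :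
    modterm R X -> modterm R X -> Prop :=
| modcong_rel u v : rel u v -> modcong rel u v
| modcong_refl u : modcong rel u u
| modcong_sym u v : modcong rel u v -> modcong rel v u
| modcong_trans u v w : modcong rel u v -> modcong rel v w -> modcong rel u w
| modcong_opp u u' : modcong rel u u' -> modcong rel (MOpp u) (MOpp u')
| modcong_add u u' v v' : modcong rel u u' -> modcong rel v v' ->
    modcong rel (MAdd u v) (MAdd u' v')
| modcong_scale a u u' : modcong rel u u' ->
    modcong rel (MScale a u) (MScale a u')
| modcong_addA u v w :
    modcong rel (MAdd u (MAdd v w)) (MAdd (MAdd u v) w)
| modcong_addC u v : modcong rel (MAdd u v) (MAdd v u)
| modcong_add0 u : modcong rel (MAdd MZero u) u
| modcong_addN u : modcong rel (MAdd (MOpp u) u) MZero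
| modcong_scaleA a b u :
    modcong rel (MScale a (MScale b u)) (MScale (a * b) u)
| modcong_scale1 u : modcong rel (MScale 1 u) u
| modcong_scaleDr a u v :
    modcong rel (MScale a (MAdd u v)) (MAdd (MScale a u) (MScale a v))
| modcong_scaleDl a b u :
    modcong rel (MScale (a + b) u) (MAdd (MScale a u) (MScale b u)).

Section PresMod.
Variables (R : pzRingType) (X : Type).
Variable rel : modterm R X -> modterm R X -> Prop.

Definition modeqv (u v : modterm R X) : bool := `[< modcong rel u v >].

Fact modeqv_refl : reflexive modeqv.
Proof. by move=> u; apply/asboolP; apply: modcong_refl. Qed.

Fact modeqv_sym : symmetric modeqv.
Proof.
by move=> u v; apply/asboolP/asboolP; apply: modcong_sym.
Qed.

Fact modeqv_trans : transitive modeqv.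
Proof.
move=> v u w /asboolP uv /asboolP vw; apply/asboolP.
exact: modcong_trans uv vw.
Qed.

Canonical mod_equiv := EquivRel modeqv modeqv_refl modeqv_sym modeqv_trans.

Definition presmod : Type := {eq_quot mod_equiv}.

HB.instance Definition _ := Choice.on presmod.

Definition presmod_pi (u : modterm R X) : presmod := \pi_{eq_quot mod_equiv} u.

Definition presmod_repr (u : presmod) : modterm R X :=
  repr (u : {eq_quot mod_equiv}).

Lemma presmod_reprK : cancel presmod_repr presmod_pi.
Proof. exact: reprK. Qed.

Lemma presmod_piP u v : presmod_pi u = presmod_pi v <-> modcong rel u v.
Proof. by split=> [/eqmodP/asboolP//|H]; apply/eqmodP/asboolP. Qed.

Definition presmod_gen (x : X) : presmod := presmod_pi (MGen x).

Definition presmod_zero : presmod := presmod_pi MZero.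
Definition presmod_opp (u : presmod) := presmod_pi (MOpp (presmod_repr u)).
Definition presmod_add (u v : presmod) :=
  presmod_pi (MAdd (presmod_repr u) (presmod_repr v)).
Definition presmod_scale (a : R) (u : presmod) :=
  presmod_pi (MScale a (presmod_repr u)).

Lemma presmod_pi_opp u : presmod_opp (presmod_pi u) = presmod_pi (MOpp u).
Proof.
apply/presmod_piP; apply: modcong_opp.
by apply/presmod_piP; rewrite presmod_reprK.
Qed.

Lemma presmod_pi_add u v :
  presmod_add (presmod_pi u) (presmod_pi v) = presmod_pi (MAdd u v).
Proof.
by apply/presmod_piP; apply: modcong_add; apply/presmod_piP;
  rewrite presmod_reprK.
Qed.

Lemma presmod_pi_scale a u :
  presmod_scale a (presmod_pi u) = presmod_pi (MScale a u).
Proof.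
apply/presmod_piP; apply: modcong_scale.
by apply/presmod_piP; rewrite presmod_reprK.
Qed.

Let presW (P : presmod -> Prop) : (forall x, P (presmod_pi x)) -> forall u, P u.
Proof. by move=> H u; rewrite -[u]presmod_reprK. Qed.

Fact presmod_addA : associative presmod_add.
Proof.
do 3!elim/presW => ?; rewrite !presmod_pi_add.
by apply/presmod_piP/modcong_addA.
Qed.
Fact presmod_addC : commutative presmod_add.
Proof.
do 2!elim/presW => ?; rewrite !presmod_pi_add.
by apply/presmod_piP/modcong_addC.
Qed.
Fact presmod_add0 : left_id presmod_zero presmod_add.
Proof.
elim/presW => ?; rewrite presmod_pi_add.
by apply/presmod_piP/modcong_add0.
Qed.
Fact presmod_addN : left_inverse presmod_zero presmod_opp presmod_add.
Proof.
elim/presW => ?; rewrite presmod_pi_opp presmod_pi_add.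
by apply/presmod_piP/modcong_addN.
Qed.

HB.instance Definition _ := GRing.isZmodule.Build presmod
  presmod_addA presmod_addC presmod_add0 presmod_addN.

Fact presmod_scaleA a b u :
  presmod_scale a (presmod_scale b u) = presmod_scale (a * b) u.
Proof.
elim/presW: u => ?; rewrite !presmod_pi_scale.
by apply/presmod_piP/modcong_scaleA.
Qed.
Fact presmod_scale1 : left_id 1 presmod_scale.
Proof.
by elim/presW => ?; rewrite presmod_pi_scale; apply/presmod_piP/modcong_scale1.
Qed.
Fact presmod_scaleDr : right_distributive presmod_scale +%R.
Proof.
move=> a; do 2!elim/presW => ?.
rewrite -[_ + _]/(presmod_add _ _) -[RHS]/(presmod_add _ _).
rewrite !(presmod_pi_add, presmod_pi_scale).
by apply/presmod_piP/modcong_scaleDr.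
Qed.
Fact presmod_scaleDl u : {morph presmod_scale^~ u : a b / a + b}.
Proof.
move=> a b; elim/presW: u => u.
rewrite -[RHS]/(presmod_add _ _) !(presmod_pi_add, presmod_pi_scale).
by apply/presmod_piP/modcong_scaleDl.
Qed.

HB.instance Definition _ := GRing.Zmodule_isLmodule.Build R presmod
  presmod_scaleA presmod_scale1 presmod_scaleDr presmod_scaleDl.

End PresMod.

Inductive kahler_rel (R : comPzRingType) : modterm R R -> modterm R R -> Prop :=
| kahlerD r s : kahler_rel (MGen (r + s)) (MAdd (MGen r) (MGen s))
| kahlerM r s :
    kahler_rel (MGen (r * s)) (MAdd (MScale r (MGen s)) (MScale s (MGen r))).

(** [kahler_rel] imposes no base ring: these are the differentials over Z. *)
Definition Omega (R : comPzRingType) : lmodType R := presmod (@kahler_rel R).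

Definition diff (R : comPzRingType) (r : R) : Omega R :=
  presmod_gen (@kahler_rel R) r.

Section TauDifferentials.
Variables (K R : comPzRingType) (delta : K -> K) (iota : {rmorphism K -> R}).

Inductive tau_rel : modterm R R -> modterm R R -> Prop :=
| tauD r s : tau_rel (MGen (r + s)) (MAdd (MGen r) (MGen s))
| tauM r s :
    tau_rel (MGen (r * s)) (MAdd (MScale r (MGen s)) (MScale s (MGen r)))
| tauK a b :
    tau_rel (MScale (iota (delta a)) (MGen (iota b)))
            (MScale (iota (delta b)) (MGen (iota a))).

Definition OmegaTau : lmodType R := presmod tau_rel.

Definition tau (r : R) : OmegaTau := presmod_gen tau_rel r.

End TauDifferentials.

(** [Sym M] is the commutative R-algebra generated by symbols [SElt m] with the
    relations making [SElt] R-linear. *)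

Inductive symterm (R M : Type) : Type :=
| SConst of R
| SElt of M
| SOpp of symterm R M
| SAdd of symterm R M & symterm R M
| SMul of symterm R M & symterm R M.
Arguments SConst {R M}.
Arguments SElt {R M}.

HB.instance Definition _ R M := gen_eqMixin (symterm R M).
HB.instance Definition _ R M := gen_choiceMixin (symterm R M).

Inductive symcong (R : comPzRingType) (M : lmodType R) :
    symterm R M -> symterm R M -> Prop :=
| symcong_refl u : symcong u u
| symcong_sym u v : symcong u v -> symcong v u
| symcong_trans u v w : symcong u v -> symcong v w -> symcong u w
| symcong_opp u u' : symcong u u' -> symcong (SOpp u) (SOpp u')
| symcong_add u u' v v' : symcong u u' -> symcong v v' ->
    symcong (SAdd u v) (SAdd u' v')
| symcong_mul u u' v v' : symcong u u' -> symcong v v' ->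
    symcong (SMul u v) (SMul u' v')
| symcong_addA u v w : symcong (SAdd u (SAdd v w)) (SAdd (SAdd u v) w)
| symcong_addC u v : symcong (SAdd u v) (SAdd v u)
| symcong_add0 u : symcong (SAdd (SConst 0) u) u
| symcong_addN u : symcong (SAdd (SOpp u) u) (SConst 0)
| symcong_mulA u v w : symcong (SMul u (SMul v w)) (SMul (SMul u v) w)
| symcong_mulC u v : symcong (SMul u v) (SMul v u)
| symcong_mul1 u : symcong (SMul (SConst 1) u) u
| symcong_mulDl u v w :
    symcong (SMul (SAdd u v) w) (SAdd (SMul u w) (SMul v w))
| symcong_constD a b : symcong (SConst (a + b)) (SAdd (SConst a) (SConst b))
| symcong_constM a b : symcong (SConst (a * b)) (SMul (SConst a) (SConst b))
| symcong_eltD m n : symcong (SElt (m + n)) (SAdd (SElt m) (SElt n))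
| symcong_eltZ a m : symcong (SElt (a *: m)) (SMul (SConst a) (SElt m)).

Section Sym.
Variables (R : comPzRingType) (M : lmodType R).

Definition symeqv (u v : symterm R M) : bool := `[< symcong u v >].

Fact symeqv_refl : reflexive symeqv.
Proof. by move=> u; apply/asboolP; apply: symcong_refl. Qed.

Fact symeqv_sym : symmetric symeqv.
Proof. by move=> u v; apply/asboolP/asboolP; apply: symcong_sym. Qed.

Fact symeqv_trans : transitive symeqv.
Proof.
move=> v u w /asboolP uv /asboolP vw; apply/asboolP.
exact: symcong_trans uv vw.
Qed.

Canonical sym_equiv := EquivRel symeqv symeqv_refl symeqv_sym symeqv_trans.

Definition Sym : Type := {eq_quot sym_equiv}.

HB.instance Definition _ := Choice.on Sym.

Definition sym_pi (u : symterm R M) : Sym := \pi_{eq_quot sym_equiv} u.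

Definition sym_repr (u : Sym) : symterm R M := repr (u : {eq_quot sym_equiv}).

Lemma sym_reprK : cancel sym_repr sym_pi.
Proof. exact: reprK. Qed.

Lemma sym_piP u v : sym_pi u = sym_pi v <-> symcong u v.
Proof. by split=> [/eqmodP/asboolP//|H]; apply/eqmodP/asboolP. Qed.

Definition sym_const (a : R) : Sym := sym_pi (SConst a).
Definition sym_elt (m : M) : Sym := sym_pi (SElt m).

Definition sym_opp (u : Sym) := sym_pi (SOpp (sym_repr u)).
Definition sym_add (u v : Sym) := sym_pi (SAdd (sym_repr u) (sym_repr v)).
Definition sym_mul (u v : Sym) := sym_pi (SMul (sym_repr u) (sym_repr v)).

Lemma sym_pi_opp u : sym_opp (sym_pi u) = sym_pi (SOpp u).
Proof. by apply/sym_piP/symcong_opp/sym_piP; rewrite sym_reprK. Qed.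

Lemma sym_pi_add u v : sym_add (sym_pi u) (sym_pi v) = sym_pi (SAdd u v).
Proof. by apply/sym_piP/symcong_add; apply/sym_piP; rewrite sym_reprK. Qed.

Lemma sym_pi_mul u v : sym_mul (sym_pi u) (sym_pi v) = sym_pi (SMul u v).
Proof. by apply/sym_piP/symcong_mul; apply/sym_piP; rewrite sym_reprK. Qed.

Let symW (P : Sym -> Prop) : (forall x, P (sym_pi x)) -> forall u, P u.
Proof. by move=> H u; rewrite -[u]sym_reprK. Qed.

Fact sym_addA : associative sym_add.
Proof.
by do 3!elim/symW => ?; rewrite !sym_pi_add; apply/sym_piP/symcong_addA.
Qed.
Fact sym_addC : commutative sym_add.
Proof.
by do 2!elim/symW => ?; rewrite !sym_pi_add; apply/sym_piP/symcong_addC.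
Qed.
Fact sym_add0 : left_id (sym_const 0) sym_add.
Proof. by elim/symW => ?; rewrite sym_pi_add; apply/sym_piP/symcong_add0. Qed.
Fact sym_addN : left_inverse (sym_const 0) sym_opp sym_add.
Proof.
by elim/symW => ?; rewrite sym_pi_opp sym_pi_add; apply/sym_piP/symcong_addN.
Qed.

HB.instance Definition _ := GRing.isZmodule.Build Sym
  sym_addA sym_addC sym_add0 sym_addN.

Fact sym_mulA : associative sym_mul.
Proof.
by do 3!elim/symW => ?; rewrite !sym_pi_mul; apply/sym_piP/symcong_mulA.
Qed.
Fact sym_mulC : commutative sym_mul.
Proof.
by do 2!elim/symW => ?; rewrite !sym_pi_mul; apply/sym_piP/symcong_mulC.
Qed.
Fact sym_mul1 : left_id (sym_const 1) sym_mul.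
Proof. by elim/symW => ?; rewrite sym_pi_mul; apply/sym_piP/symcong_mul1. Qed.
Fact sym_mulDl : left_distributive sym_mul +%R.
Proof.
do 3!elim/symW => ?.
rewrite -[_ + _]/(sym_add _ _) -[RHS]/(sym_add _ _).
rewrite !(sym_pi_mul, sym_pi_add).
by apply/sym_piP/symcong_mulDl.
Qed.

HB.instance Definition _ := GRing.Zmodule_isComPzRing.Build Sym
  sym_mulA sym_mulC sym_mul1 sym_mulDl.

Lemma sym_constD : {morph sym_const : a b / a + b}.
Proof.
move=> a b; rewrite -[RHS]/(sym_add _ _) sym_pi_add.
by apply/sym_piP/symcong_constD.
Qed.
Fact sym_const_is_zmod_morphism : zmod_morphism sym_const.
Proof. by move=> a b; apply/eqP; rewrite eq_sym subr_eq -sym_constD subrK. Qed.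
Fact sym_const_is_monoid_morphism : monoid_morphism sym_const.
Proof.
split=> // a b; rewrite -[RHS]/(sym_mul _ _) sym_pi_mul.
by apply/sym_piP/symcong_constM.
Qed.

HB.instance Definition _ := GRing.isZmodMorphism.Build R Sym sym_const
  sym_const_is_zmod_morphism.
HB.instance Definition _ := GRing.isMonoidMorphism.Build R Sym sym_const
  sym_const_is_monoid_morphism.

End Sym.

Section Prolongation.
Variables (K R : comPzRingType) (delta : K -> K) (iota : {rmorphism K -> R}).

Definition prol_ideal : ideal (Sym (Omega R)) :=
  ideal_gen (range (fun a : K =>
    sym_elt (diff (iota a)) - sym_const (Omega R) (iota (delta a)))).

Definition prolongation : Type := quotring prol_ideal.

HB.instance Definition _ := GRing.ComPzRing.on prolongation.

Definition prol_const (r : R) : prolongation :=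
  quotring_pi prol_ideal (sym_const (Omega R) r).

Definition delta1 (r : R) : prolongation :=
  quotring_pi prol_ideal (sym_elt (diff r)).

Definition prol_scale (r : R) (x : prolongation) : prolongation :=
  prol_const r * x.

Fact prol_scaleA r s x :
  prol_scale r (prol_scale s x) = prol_scale (r * s) x.
Proof. by rewrite /prol_scale mulrA /prol_const !rmorphM. Qed.
Fact prol_scale1 : left_id 1 prol_scale.
Proof. by move=> x; rewrite /prol_scale /prol_const !rmorph1 mul1r. Qed.
Fact prol_scaleDr : right_distributive prol_scale +%R.
Proof. by move=> r x y; rewrite /prol_scale mulrDr. Qed.
Fact prol_scaleDl x : {morph prol_scale^~ x : r s / r + s}.
Proof. by move=> r s; rewrite /prol_scale /prol_const !rmorphD mulrDl. Qed.

HB.instance Definition _ := GRing.Zmodule_isLmodule.Build R prolongation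
  prol_scaleA prol_scale1 prol_scaleDr prol_scaleDl.

Lemma delta1D : {morph delta1 : r s / r + s}.
Proof.
move=> r s; rewrite /delta1 -rmorphD; congr quotring_pi.
rewrite -[RHS]/(sym_add _ _) sym_pi_add.
have -> : diff (r + s) = diff r + diff s.
  rewrite -[RHS]/(presmod_add _ _) presmod_pi_add.
  by apply/presmod_piP/modcong_rel/kahlerD.
exact/sym_piP/symcong_eltD.
Qed.

Lemma delta1M r s : delta1 (r * s) = r *: delta1 s + s *: delta1 r.
Proof.
have -> : r *: delta1 s + s *: delta1 r =
    prol_const r * delta1 s + prol_const s * delta1 r by [].
rewrite /delta1 /prol_const -!rmorphM -rmorphD; congr quotring_pi.
have -> : diff (r * s) = r *: diff s + s *: diff r.
  rewrite -[RHS]/(presmod_add (presmod_scale _ _) (presmod_scale _ _)).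
  rewrite !presmod_pi_scale presmod_pi_add.
  by apply/presmod_piP/modcong_rel/kahlerM.
rewrite -[RHS]/(sym_add (sym_mul _ _) (sym_mul _ _)) !sym_pi_mul sym_pi_add.
apply/sym_piP; apply: symcong_trans (symcong_eltD _ _) _.
by apply: symcong_add; apply: symcong_eltZ.
Qed.

Lemma delta1_iota a : delta1 (iota a) = prol_const (iota (delta a)).
Proof. by apply/quotring_piP => I; apply; exists a. Qed.

End Prolongation.

(* Main.v *)
Require Import Defs.
From HB Require Import structures.
From mathcomp Require Import all_boot all_algebra.
From mathcomp Require Import classical_sets.
Import GRing.Theory.
Local Open Scope ring_scope.

(** Because [delta e = 1], the relations of the tau-differentials give
    [tau (iota a) = iota (delta a) *: tau (iota e)] for [a] in [K]; hence the
    prolongation is Sym(OmegaTau) modulo [tau (iota e) - 1]. An element [m] of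
    a module [M] can die in Sym(M) modulo [eps - 1], but not when some linear
    form [phi] on [M] satisfies [phi eps = 1]: then M splits as the free line
    on [eps] plus ker(phi), and setting [eps] to 1 gives Sym(ker(phi)), in which
    R + ker(phi) embeds.

    A linear form on the tau-differentials that sends [tau (iota e)] to 1 is the
    same thing as a derivation [D] of [R] extending [delta]. Smoothness provides
    it ([smooth_extend_derivation]): make the dual numbers over [R] a
    [K]-algebra by sending [a] to [iota a + iota (delta a) * eps], and lift the
    identity of [R] through the projection that kills [eps].

    To see injectivity it suffices to keep the degrees 0 and 1 of
    Sym(ker(phi)), that is, to map the prolongation to the square-zero extension
    of [R] by the tau-differentials, the class of [dr] going to
    [(D r, tau r - D r *: tau (iota e))] ([prolongation_to_trivext]). Composed
    with [t], this is [m |-> (phi m, m - phi m *: tau (iota e))], from which [m]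
    can be read off. *)

Set Implicit Arguments.
Unset Strict Implicit.
Unset Printing Implicit Defensive.

(** * Universal properties *)

Section PresModUniversal.
Variables (R : pzRingType) (X : Type).
Variable rel : modterm R X -> modterm R X -> Prop.

Lemma presmod_gen_ind (P : presmod rel -> Prop) :
    (forall x, P (presmod_gen rel x)) -> P 0 ->
    (forall u, P u -> P (- u)) ->
    (forall u v, P u -> P v -> P (u + v)) ->
    (forall a u, P u -> P (a *: u)) ->
  forall u, P u.
Proof.
move=> Pgen P0 PN PD PZ u; rewrite -[u]presmod_reprK.
elim: (presmod_repr u) => [x||v IHv|v IHv w IHw|a v IHv].
- exact: Pgen.
- exact: P0.
- by rewrite -presmod_pi_opp; apply: PN.
- by rewrite -presmod_pi_add; apply: PD.
- by rewrite -presmod_pi_scale; apply: PZ.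
Qed.

Lemma presmod_linear_unique (V : lmodType R) (f g : {linear presmod rel -> V}) :
  (forall x, f (presmod_gen rel x) = g (presmod_gen rel x)) -> f =1 g.
Proof.
move=> fg; apply: presmod_gen_ind => [//||u IH|u v IHu IHv|a u IH].
- by rewrite !raddf0.
- by rewrite !raddfN /= IH.
- by rewrite !raddfD /= IHu IHv.
- by rewrite !linearZ /= IH.
Qed.

Variables (V : lmodType R) (f : X -> V).

Fixpoint modterm_eval (u : modterm R X) : V :=
  match u with
  | MGen x => f x
  | MZero => 0
  | MOpp v => - modterm_eval v
  | MAdd v w => modterm_eval v + modterm_eval w
  | MScale a v => a *: modterm_eval v
  end.

Hypothesis f_rel : forall u v, rel u v -> modterm_eval u = modterm_eval v.

Lemma modcong_eval u v : modcong rel u v -> modterm_eval u = modterm_eval v.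
Proof.
elim=> //=.
- by move=> ? ? ? _ -> _ ->.
- by move=> ? ? _ ->.
- by move=> ? ? ? ? _ -> _ ->.
- by move=> ? ? ? _ ->.
- by move=> *; rewrite addrA.
- by move=> *; rewrite addrC.
- by move=> *; rewrite add0r.
- by move=> *; rewrite addNr.
- by move=> *; rewrite scalerA.
- by move=> *; rewrite scale1r.
- by move=> *; rewrite scalerDr.
- by move=> *; rewrite scalerDl.
Qed.

Lemma presmod_lift :
  exists g : {linear presmod rel -> V}, forall x, g (presmod_gen rel x) = f x.
Proof.
pose g (u : presmod rel) := modterm_eval (presmod_repr u).
have g_pi u : g (presmod_pi rel u) = modterm_eval u.
  by apply: modcong_eval; apply/presmod_piP; rewrite presmod_reprK.
have g_lin : linear g.
  move=> a u v; rewrite -[u]presmod_reprK -[v]presmod_reprK.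
  rewrite -[_ + _]/(presmod_add (presmod_scale _ _) _).
  by rewrite presmod_pi_scale presmod_pi_add !g_pi.
pose lin := GRing.isLinear.Build R (presmod rel) V *:%R g g_lin.
pose G : {linear presmod rel -> V} := HB.pack g lin.
by exists G => x; apply: (g_pi (MGen x)).
Qed.

End PresModUniversal.

Section SymUniversal.
Variables (R : comPzRingType) (M : lmodType R) (C : comPzRingType).
Variables (c : {rmorphism R -> C}) (h : M -> C).
Hypotheses (hD : {morph h : m n / m + n})
           (hZ : forall a m, h (a *: m) = c a * h m).

Fixpoint symterm_eval (u : symterm R M) : C :=
  match u with
  | SConst a => c a
  | SElt m => h m
  | SOpp v => - symterm_eval v
  | SAdd v w => symterm_eval v + symterm_eval w
  | SMul v w => symterm_eval v * symterm_eval w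
  end.

Lemma symcong_eval u v : symcong u v -> symterm_eval u = symterm_eval v.
Proof.
elim=> //=.
- by move=> ? ? ? _ -> _ ->.
- by move=> ? ? _ ->.
- by move=> ? ? ? ? _ -> _ ->.
- by move=> ? ? ? ? _ -> _ ->.
- by move=> *; rewrite addrA.
- by move=> *; rewrite addrC.
- by move=> *; rewrite rmorph0 add0r.
- by move=> *; rewrite rmorph0 addNr.
- by move=> *; rewrite mulrA.
- by move=> *; rewrite mulrC.
- by move=> *; rewrite rmorph1 mul1r.
- by move=> *; rewrite mulrDl.
- by move=> *; rewrite rmorphD.
- by move=> *; rewrite rmorphM.
Qed.

Lemma sym_lift : exists g : {rmorphism Sym M -> C},
  (forall a, g (sym_const M a) = c a) /\ (forall m, g (sym_elt m) = h m).
Proof.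
pose g (u : Sym M) := symterm_eval (sym_repr u).
have g_pi u : g (sym_pi u) = symterm_eval u.
  by apply: symcong_eval; apply/sym_piP; rewrite sym_reprK.
have gB : zmod_morphism g.
  move=> u v; rewrite -[u]sym_reprK -[v]sym_reprK.
  rewrite -[_ - _]/(sym_add _ (sym_opp _)).
  by rewrite sym_pi_opp sym_pi_add !g_pi.
have gM : monoid_morphism g.
  split=> [|u v]; first by rewrite (g_pi (SConst 1)) /= rmorph1.
  rewrite -[u]sym_reprK -[v]sym_reprK.
  by rewrite -[_ * _]/(sym_mul _ _) sym_pi_mul !g_pi.
pose addg := GRing.isZmodMorphism.Build (Sym M) C g gB.
pose mulg := GRing.isMonoidMorphism.Build (Sym M) C g gM.
pose G : {rmorphism Sym M -> C} := HB.pack g addg mulg.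
by exists G; split=> [a|m]; [apply: (g_pi (SConst a)) | apply: (g_pi (SElt m))].
Qed.

End SymUniversal.

Section QuotUniversal.
Variables (A B : comPzRingType) (h : {rmorphism A -> B}).

Fact ker_ideal0 : h 0 = 0. Proof. exact: rmorph0. Qed.
Fact ker_idealD x y : h x = 0 -> h y = 0 -> h (x + y) = 0.
Proof. by move=> hx hy; rewrite rmorphD hx hy addr0. Qed.
Fact ker_idealM a x : h x = 0 -> h (a * x) = 0.
Proof. by move=> hx; rewrite rmorphM hx mulr0. Qed.

Definition ker_ideal : ideal A :=
  @Ideal A (fun x => h x = 0) ker_ideal0 ker_idealD ker_idealM.

Lemma quotring_gen_lift (S : set A) : (forall s, S s -> h s = 0) ->
  exists g : {rmorphism quotring (ideal_gen S) -> B},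
    forall x, g (quotring_pi (ideal_gen S) x) = h x.
Proof.
move=> hS; set I := ideal_gen S.
pose g (u : quotring I) := h (quotring_repr u).
have g_pi x : g (quotring_pi I x) = h x.
  have /(_ ker_ideal hS) /= : I (quotring_repr (quotring_pi I x) - x).
    by apply/quotring_piP; rewrite quotring_reprK.
  by rewrite rmorphB => /subr0_eq.
have gB : zmod_morphism g.
  move=> u v; rewrite -[u]quotring_reprK -[v]quotring_reprK.
  by rewrite -rmorphB !g_pi rmorphB.
have gM : monoid_morphism g.
  split=> [|u v]; first by rewrite (g_pi 1) rmorph1.
  rewrite -[u]quotring_reprK -[v]quotring_reprK.
  by rewrite -rmorphM !g_pi rmorphM.
pose addg := GRing.isZmodMorphism.Build (quotring I) B g gB.
pose mulg := GRing.isMonoidMorphism.Build (quotring I) B g gM.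
by exists (HB.pack g addg mulg : {rmorphism quotring I -> B}).
Qed.

End QuotUniversal.

Section TauUniversal.
Variables (K R : comPzRingType) (delta : K -> K) (iota : {rmorphism K -> R}).
Local Notation tau := (tau delta iota).

Lemma tauD_eq r s : tau (r + s) = tau r + tau s.
Proof.
rewrite -[RHS]/(presmod_add _ _) presmod_pi_add.
exact/presmod_piP/modcong_rel/tauD.
Qed.

Lemma tauM_eq r s : tau (r * s) = r *: tau s + s *: tau r.
Proof.
rewrite -[RHS]/(presmod_add (presmod_scale _ _) (presmod_scale _ _)).
rewrite !presmod_pi_scale presmod_pi_add.
exact/presmod_piP/modcong_rel/tauM.
Qed.

Lemma tauK_eq a b :
  iota (delta a) *: tau (iota b) = iota (delta b) *: tau (iota a).
Proof.
rewrite -[LHS]/(presmod_scale _ _) -[RHS]/(presmod_scale _ _).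
rewrite !presmod_pi_scale.
exact/presmod_piP/modcong_rel/tauK.
Qed.

Lemma tau_lift (V : lmodType R) (d : R -> V) :
    {morph d : r s / r + s} ->
    (forall r s, d (r * s) = r *: d s + s *: d r) ->
    (forall a b, iota (delta a) *: d (iota b) = iota (delta b) *: d (iota a)) ->
  exists g : {linear OmegaTau delta iota -> V}, forall r, g (tau r) = d r.
Proof.
by move=> dD dM dK; apply: presmod_lift => _ _ [r s|r s|a b] /=.
Qed.

End TauUniversal.

Lemma diff_lift (R : comPzRingType) (V : lmodType R) (d : R -> V) :
    {morph d : r s / r + s} ->
    (forall r s, d (r * s) = r *: d s + s *: d r) ->
  exists g : {linear Omega R -> V}, forall r, g (diff r) = d r.
Proof. by move=> dD dM; apply: presmod_lift => _ _ [r s|r s] /=. Qed.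

(** * Square-zero extensions *)

(** The alias keeps the pairs from carrying the componentwise product when
    [M] is itself a ring, as for the dual numbers [trivext R^o]. *)
Definition trivext (R : comPzRingType) (M : lmodType R) : Type := (R * M)%type.

Section TrivExt.
Variables (R : comPzRingType) (M : lmodType R).
Local Notation T := (trivext M).

HB.instance Definition _ := GRing.Zmodule.copy T (R * M)%type.

Definition trivext_one : T := (1, 0).
Definition trivext_mul (x y : T) : T := (x.1 * y.1, x.1 *: y.2 + y.1 *: x.2).

Fact trivext_mulA : associative trivext_mul.
Proof.
move=> x y z; congr (_, _) => /=; first exact: mulrA.
rewrite !scalerDr !scalerA addrA; congr (_ + _ *: _ + _ *: _); exact: mulrC.
Qed.

Fact trivext_mulC : commutative trivext_mul.
Proof. by move=> x y; congr (_, _); [exact: mulrC | exact: addrC]. Qed.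

Fact trivext_mul1 : left_id trivext_one trivext_mul.
Proof.
move=> [a m]; congr (_, _) => /=; first exact: mul1r.
by rewrite scale1r scaler0 addr0.
Qed.

Fact trivext_mulDl : left_distributive trivext_mul +%R.
Proof.
move=> x y z; congr (_, _) => /=; first exact: mulrDl.
by rewrite scalerDl scalerDr addrACA.
Qed.

HB.instance Definition _ := GRing.Zmodule_isComPzRing.Build T
  trivext_mulA trivext_mulC trivext_mul1 trivext_mulDl.

Lemma trivext_mulE (x y : T) :
  x * y = (x.1 * y.1, x.1 *: y.2 + y.1 *: x.2) :> T.
Proof. by []. Qed.

Definition trivext_fst (x : T) : R := x.1.

Fact trivext_fst_is_zmod_morphism : zmod_morphism trivext_fst.
Proof. by []. Qed.
Fact trivext_fst_is_monoid_morphism : monoid_morphism trivext_fst.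
Proof. by []. Qed.
HB.instance Definition _ := GRing.isZmodMorphism.Build T R trivext_fst
  trivext_fst_is_zmod_morphism.
HB.instance Definition _ := GRing.isMonoidMorphism.Build T R trivext_fst
  trivext_fst_is_monoid_morphism.

(** The multiplication in degree 1 is the Leibniz rule; unitality needs no
    assumption because a derivation kills 1. *)
Lemma trivext_rmorphism (A : comPzRingType) (c : {rmorphism A -> R})
    (d : A -> M) :
    {morph d : a b / a + b} ->
    (forall a b, d (a * b) = c a *: d b + c b *: d a) ->
  exists g : {rmorphism A -> T}, forall a, g a = (c a, d a).
Proof.
move=> dD dM; pose g a : T := (c a, d a).
have gB : zmod_morphism g.
  move=> a b; congr (_, _) => /=; first exact: rmorphB.
  by apply: (canRL (addrK _)); rewrite -dD subrK.
have gM : monoid_morphism g.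
  split=> [|a b]; congr (_, _) => /=; first exact: rmorph1.
  - move: (dM 1 1); rewrite rmorph1 !mulr1 !scale1r => /eqP.
    by rewrite -subr_eq0 opprD addrA subrr add0r oppr_eq0 => /eqP.
  - exact: rmorphM.
  - exact: dM.
pose addg := GRing.isZmodMorphism.Build A T g gB.
pose mulg := GRing.isMonoidMorphism.Build A T g gM.
by exists (HB.pack g addg mulg : {rmorphism A -> T}).
Qed.

End TrivExt.

(** * Extending the derivation *)

Lemma smooth_extend_derivation (K R : comPzRingType) (delta : K -> K)
    (iota : {rmorphism K -> R}) :
    derivation delta -> smooth iota ->
  exists D : R -> R, derivation D /\ forall a, D (iota a) = iota (delta a).
Proof.
move=> [deltaD deltaM] smooth_iota.
have [kappa kappaE] : exists kappa : {rmorphism K -> trivext R^o},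
    forall a, kappa a = (iota a, iota (delta a)).
  apply: (@trivext_rmorphism _ R^o) => a b /=; first by rewrite deltaD rmorphD.
  by rewrite deltaM rmorphD !rmorphM.
pose N := ker_ideal (@trivext_fst R R^o).
have N0 : square_zero N.
  move=> x y; rewrite /= /trivext_fst => x0 y0.
  by rewrite trivext_mulE x0 y0 mul0r !scale0r addr0.
have [i iE] : exists i : {rmorphism R -> trivext R^o}, forall r, i r = (r, 0).
  apply: (@trivext_rmorphism R R^o R idfun (fun _ => 0)) => r s /=.
    by rewrite addr0.
  by rewrite !scaler0 addr0.
pose f : {rmorphism R -> quotring N} := quotring_pi N \o i.
have fK a : f (iota a) = quotring_pi N (kappa a).
  apply/quotring_piP; rewrite iE kappaE /= /trivext_fst /=; exact: subrr.
have [g [gK gN]] := smooth_iota _ kappa N N0 f fK.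
have g1 r : (g r).1 = r.
  have /quotring_piP := gN r; rewrite iE /= /trivext_fst /=.
  by move/subr0_eq.
exists (fun r => (g r).2); split=> [|a]; last by rewrite gK kappaE.
split=> r s; first by rewrite rmorphD.
by rewrite rmorphM trivext_mulE /= !g1.
Qed.

(** * Embedding the tau-differentials *)

(** The degree 0 and 1 part of setting [tau (iota e)] to 1 in
    Sym(OmegaTau): on the class of [dr] the two components are the coordinate of
    [tau r] along [tau (iota e)] and its projection to the kernel of the linear
    form defined by [D]. *)
Lemma prolongation_to_trivext (K R : comPzRingType) (delta : K -> K) (e : K)
    (iota : {rmorphism K -> R}) (D : R -> R) :
    delta e = 1 -> derivation D -> (forall a, D (iota a) = iota (delta a)) ->
  exists psi : {rmorphism prolongation delta iota ->
                          trivext (OmegaTau delta iota)},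
    (forall r, psi (prol_const delta iota r) = (r, 0)) /\
    (forall r, psi (delta1 delta iota r) =
       (D r, tau delta iota r - D r *: tau delta iota (iota e))).
Proof.
move=> delta_e [DD DM] DK; set T := OmegaTau delta iota; set te := tau _ _ _.
have [i iE] : exists i : {rmorphism R -> trivext T}, forall r, i r = (r, 0).
  apply: (@trivext_rmorphism R T R idfun (fun _ => 0)) => r s /=.
    by rewrite addr0.
  by rewrite !scaler0 addr0.
have [p pE] : exists p : {linear Omega R -> R^o}, forall r, p (diff r) = D r.
  exact: diff_lift.
have [q qE] : exists q : {linear Omega R -> T},
    forall r, q (diff r) = tau delta iota r - D r *: te.
  apply: diff_lift => r s.
    by rewrite tauD_eq DD scalerDl opprD addrACA.
  by rewrite tauM_eq DM scalerDl !scalerBr !scalerA opprD addrACA.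
have [h [hc hd]] : exists h : {rmorphism Sym (Omega R) -> trivext T},
    (forall r, h (sym_const _ r) = i r) /\
    (forall m, h (sym_elt m) = (p m, q m)).
  apply: (sym_lift (h := fun m => (p m, q m) : trivext T)) => [m n|a m].
    by rewrite 2!raddfD.
  by rewrite iE trivext_mulE /= !linearZ /= scaler0 addr0.
have h0 s : range (fun a : K => sym_elt (diff (iota a)) -
    sym_const (Omega R) (iota (delta a))) s -> h s = 0.
  case=> a _ <-; rewrite rmorphB hc hd iE pE qE DK.
  (* this is where [delta e = 1] identifies [tau (iota a)] *)
  rewrite /te tauK_eq delta_e rmorph1 scale1r.
  by congr (_, _); rewrite /= !subrr.
have [psi psiE] := quotring_gen_lift h0.
by exists psi; split=> r; rewrite psiE ?hc ?hd ?iE ?pE ?qE.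
Qed.

Theorem proposition2p27 (K : fieldType) (delta : K -> K)
    (hdelta : derivation delta) (e : K) (he : delta e = 1)
    (R : comPzRingType) (iota : {rmorphism K -> R}) (hR : smooth iota) :
  exists t : {linear OmegaTau delta iota -> prolongation delta iota},
    [/\ forall r : R, t (tau delta iota r) = delta1 delta iota r,
        forall t' : {linear OmegaTau delta iota -> prolongation delta iota},
          (forall r : R, t' (tau delta iota r) = delta1 delta iota r) ->
          t' =1 t
      & injective t].
Proof.
have [t tE] : exists t : {linear OmegaTau delta iota -> prolongation delta iota},
    forall r, t (tau delta iota r) = delta1 delta iota r.
  apply: tau_lift; [exact: delta1D | exact: delta1M | move=> a b].
  by rewrite !delta1_iota [LHS]mulrC.
exists t; split=> // [t' t'E|].
  by apply: presmod_linear_unique => r; rewrite -/(tau _ _ r) tE t'E.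
have [D [Dder DK]] := smooth_extend_derivation hdelta hR.
have [DD DM] := Dder.
have [phi phiE] : exists phi : {linear OmegaTau delta iota -> R^o},
    forall r, phi (tau delta iota r) = D r.
  by apply: tau_lift => // a b; rewrite !DK [LHS]mulrC.
have [psi [psic psid]] := prolongation_to_trivext he Dder DK.
set te := tau delta iota (iota e) in psid.
have psit m : psi (t m) = (phi m, m - phi m *: te).
  elim/presmod_gen_ind: m => [r||u IHu|u v IHu IHv|a u IHu].
  - by rewrite -/(tau delta iota r) tE psid phiE.
  - by rewrite !raddf0 scale0r subr0.
  - rewrite [t (- u)]raddfN [LHS]rmorphN /= IHu [phi (- u)]raddfN.
    by congr (_, _); rewrite scaleNr opprB opprK addrC.
  - rewrite [t (u + v)]raddfD [LHS]rmorphD /= IHu IHv.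
    rewrite [phi (u + v)]raddfD; congr (_, _).
    by rewrite /= scalerDl opprD addrACA.
  - rewrite [t (a *: u)]linearZ [phi (a *: u)]linearZ.
    rewrite -[X in psi X]/(prol_const delta iota a * t u).
    rewrite rmorphM psic IHu trivext_mulE /= scaler0 addr0.
    by rewrite scalerBr scalerA.
move=> m n /(congr1 psi); rewrite !psit => -[phimn].
by rewrite phimn => /addIr.
Qed.
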